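(* Let $q$ be strict, let $m\in\mathbb N^d$, and let $G=(G_k)_{k\in\mathbb N^d}$ and $L=(L_k)_{k\in\mathbb N^d}$ be sequences of real-valued measurable functions on $\mathsf X$ such that $L_k=G_k+(q*L)_k$ for every $k\in[0,m]_d$. Extend $L_r$ and $G_r$ by zero when $r\notin\mathbb N^d$, and let $\sigma_m=\inf\{n\ge0:S_n\not\leq_dm\}$. Assume that $L_r$ and $G_r$ are integrable at the points $r\in[0,m]_d$ visited before $\sigma_m$, i.e. for every $n\ge0$ the random variables $\mathbf 1_{\{n<\sigma_m\}}L_{m-S_n}(J_n)$ and $\mathbf 1_{\{n<\sigma_m\}}G_{m-S_n}(J_n)$ are integrable. Then $$M_n=L_{m-S_{n\wedge\sigma_m}}(J_{n\wedge\sigma_m})+\sum_{j=0}^{n\wedge\sigma_m-1}G_{m-S_j}(J_j),\qquad n\ge0,$$ is a martingale with respect to $\mathcal F_n=\sigma(J_0,S_0,\dots,J_n,S_n)$.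
   Context: $\mathbb N=\{0,1,2,\dots\}$, $d\ge1$; $r\leq_dk$ means $r_j\le k_j$ for all $j$; $0_d$ is the zero vector; $[0,m]_d=\{r\in\mathbb N^d:r\leq_dm\}$. $(\mathsf X,\mathcal X)$ is a standard Borel space and $q=(q_k)_{k\in\mathbb N^d}$ is a family of non-negative kernels on $\mathsf X$ with $\sum_kq_k(x,\mathsf X)=1$ for all $x$; strict means $q_{0_d}=0$. The Markov renewal chain $(J_n,S_n)_{n\ge0}$ (with an arbitrary initial law for $J_0$) has $S_0=0_d$ and $\mathbb P(J_{n+1}\in A,S_{n+1}-S_n=k\mid J_0,S_0,\dots,J_n,S_n)=q_k(J_n,A)$. $(q*L)_k(x)=\sum_{r\leq_dk}\int_{\mathsf X}q_r(x,dy)L_{k-r}(y)$, the integrals in the equation $L=G+q*L$ being assumed to converge absolutely. Since $q$ is strict, $\sigma_m\le|m|_1+1$ almost surely, where $|m|_1=m_1+\cdots+m_d$. *)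

(* Defs.v *)
From HB Require Import structures.
From mathcomp Require Import all_boot all_order all_algebra.
From mathcomp Require Import all_classical all_reals all_analysis.

Set Implicit Arguments.
Unset Strict Implicit.
Unset Printing Implicit Defensive.

Import Order.TTheory GRing.Theory Num.Theory.
Import numFieldNormedType.Exports.

Local Open Scope classical_set_scope.
Local Open Scope ring_scope.

Definition polish (R : realType) (M : metricType R) : Prop :=
  (forall F : set_system M, ProperFilter F -> cauchy F -> exists x : M, F --> x)
  /\ (exists2 D : set M, countable D & dense D).

Definition standard_borel (R : realType) (d : measure_display)
    (X : measurableType d) : Prop :=
  exists (M : metricType R) (f : X -> M),
    [/\ polish M, bijective f &
      (measurable : set (set X)) =
        preimage_set_system setT f (<<s (open : set (set M)) >>)].

Definition natvec (d : nat) := {ffun 'I_d -> nat}.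

HB.instance Definition _ d := GRing.Nmodule.on (natvec d).
HB.instance Definition _ d := isPointed.Build (natvec d) 0.
HB.instance Definition _ d := @isMeasurable.Build default_measure_display
  (natvec d) discrete_measurable discrete_measurable0
  discrete_measurableC discrete_measurableU.

Definition vle d (r k : natvec d) : bool := [forall j, (r j <= k j)%N].

Definition box d (m : natvec d) : set (natvec d) := [set r | vle r m].

(* The subtraction is truncated: this is only meaningful when [vle r k]. *)
Definition vsub d (k r : natvec d) : natvec d := [ffun j => (k j - r j)%N].

Definition intvec d (k : natvec d) : {ffun 'I_d -> int} :=
  [ffun j => (k j)%:Z].

(* Extension of a family indexed by N^d to indices in Z^d, by zero. *)
Definition zext (R : realType) d (T : Type) (F : natvec d -> T -> R)
    (r : {ffun 'I_d -> int}) (x : T) : R :=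
  if [forall j, 0 <= r j] then F [ffun j => `|r j|%N] x else 0.

Section renewal_kernel.
Context (R : realType) (d : nat) (dX : measure_display) (X : measurableType dX).
Variable q : natvec d -> R.-ker X ~> X.

Definition total_mass_one : Prop :=
  forall x, (\esum_(k in [set: natvec d]) q k x setT = 1)%E.

Definition strict_kernel : Prop := forall x A, measurable A -> q 0 x A = 0%E.

Definition kconv (L : natvec d -> X -> R) (k : natvec d) (x : X) : R :=
  \sum_(r \in box k) \int[q r x]_y L (vsub k r) y.

Definition kconv_converges (L : natvec d -> X -> R) (k : natvec d) : Prop :=
  forall x r, box k r ->
    (q r x).-integrable setT (EFin \o L (vsub k r)).

End renewal_kernel.

Section probability.
Context (R : realType) (dO : measure_display) (Omega : measurableType dO).
Variable P : probability Omega R.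

Definition measurable_wrt (F : set_system Omega) (Y : Omega -> R) : Prop :=
  preimage_set_system setT Y measurable `<=` F.

(* [Y] is a version of the conditional expectation of [Z] given [F]. *)
Definition is_condexp (F : set_system Omega) (Z Y : Omega -> R) : Prop :=
  [/\ P.-integrable setT (EFin \o Z),
      P.-integrable setT (EFin \o Y),
      measurable_wrt F Y &
      forall B, F B ->
        (\int[P]_(w in B) (Y w)%:E = \int[P]_(w in B) (Z w)%:E)%E].

Definition filtration (F : nat -> set_system Omega) : Prop :=
  [/\ forall n, sigma_algebra setT (F n),
      forall n, F n `<=` measurable &
      forall n, F n `<=` F n.+1].

Definition martingale (F : nat -> set_system Omega) (M : nat -> Omega -> R)
    : Prop :=
  [/\ filtration F,
      forall n, measurable_wrt (F n) (M n),
      forall n, P.-integrable setT (EFin \o M n) &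
      forall n, is_condexp (F n) (M n.+1) (M n)].

End probability.

Section markov_renewal_chain.
Context (R : realType) (d : nat) (dX dO : measure_display)
  (X : measurableType dX) (Omega : measurableType dO).
Variable P : probability Omega R.
Variables (J : nat -> {RV P >-> X}) (S : nat -> {RV P >-> natvec d}).

Definition history (n : nat) : set_system Omega :=
  <<s \bigcup_(i in [set i | (i <= n)%N])
        (preimage_set_system setT (J i) measurable `|`
         preimage_set_system setT (S i) measurable) >>.

Definition markov_renewal_chain (q : natvec d -> R.-ker X ~> X) : Prop :=
  {ae P, forall w, S 0%N w = 0} /\
  forall (n : nat) (k : natvec d) (A : set X), measurable A ->
    is_condexp P (history n)
      \1_[set w | A (J n.+1 w) /\ S n.+1 w = S n w + k]
      (fun w => fine (q k (J n w) A)).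

(* First exit time from the box; [None] stands for infinity. *)
Definition exit_time (m : natvec d) (w : Omega) : option nat :=
  match pselect (exists n, ~~ vle (S n w) m) with
  | left ex => Some (ex_minn ex)
  | right _ => None
  end.

Definition stop (n : nat) (s : option nat) : nat :=
  if s is Some k then minn n k else n.

Definition before (n : nat) (s : option nat) : bool :=
  if s is Some k then (n < k)%N else true.

Definition renewal_term (F : natvec d -> X -> R) (m : natvec d) (n : nat)
    (w : Omega) : R :=
  zext F (intvec m - intvec (S n w)) (J n w).

Definition renewal_process (G L : natvec d -> X -> R) (m : natvec d)
    (n : nat) (w : Omega) : R :=
  let N := stop n (exit_time m w) in
  renewal_term L m N w + \sum_(0 <= j < N) renewal_term G m j w.

End markov_renewal_chain.

(* Main.v *)
(* With sigma the exit time, M_n = U_n + V_0 + ... + V_(n-1), where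
   U_n = 1_{n < sigma} L_{m - S_n}(J_n) and V_n is its analogue for G, so it is
   enough that E[U_(n+1) | F_n] = U_n - V_n. On {n < sigma, S_n = s} the right
   side is (q * L)_{m - s}(J_n), a finite sum over r of integrals against
   q_r(J_n, .). The term of index r is the conditional expectation of
   U_(n+1) 1_{S_n = s, S_(n+1) = s + r}: the chain property gives this for
   indicators of J_(n+1), hence for integrable functions. These events exhaust
   {n + 1 < sigma} because the total mass one of q forces S_(n+1) - S_n to lie
   in N^d almost surely. *)
Require Import Defs.
From HB Require Import structures.
From mathcomp Require Import all_boot all_order all_algebra.
From mathcomp Require Import all_classical all_reals all_analysis.
From mathcomp Require Import measurable_realfun zify.

Set Implicit Arguments.
Unset Strict Implicit.
Unset Printing Implicit Defensive.

Import Order.TTheory GRing.Theory Num.Theory.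
Import numFieldNormedType.Exports.

Local Open Scope classical_set_scope.
Local Open Scope ring_scope.

(** * Conditional expectation: sums and almost sure modification *)

Section conditional_expectation.
Context (R : realType) (dO : measure_display) (Omega : measurableType dO).
Variables (P : probability Omega R) (F : set_system Omega).
Hypothesis sF : sigma_algebra [set: Omega] F.
Hypothesis Fm : F `<=` measurable.

(** Since [F] is already a sigma-algebra, generating from it adds no set. This gives access to the
    closure rules of [measurable_fun]. *)
Lemma measurable_wrtP (Y : Omega -> R) : measurable_wrt F Y <->
  measurable_fun [set: g_sigma_algebraType F] (Y : g_sigma_algebraType F -> R).
Proof.
have FE := measurable_g_measurableTypeE sF.
split=> [FY _ B mB|mY _ [B mB <-]].
  by rewrite FE; apply: FY; exists B.
by rewrite -FE; exact: mY.
Qed.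

Lemma measurable_wrtD (Y Z : Omega -> R) :
  measurable_wrt F Y -> measurable_wrt F Z ->
  measurable_wrt F (fun w => Y w + Z w).
Proof.
by rewrite !measurable_wrtP => mY mZ; exact: measurable_funD.
Qed.

Lemma is_condexpD (Z1 Y1 Z2 Y2 : Omega -> R) :
  is_condexp P F Z1 Y1 -> is_condexp P F Z2 Y2 ->
  is_condexp P F (fun w => Z1 w + Z2 w) (fun w => Y1 w + Y2 w).
Proof.
move=> [iZ1 iY1 mY1 e1] [iZ2 iY2 mY2 e2]; split.
- exact: (integrableD measurableT iZ1 iZ2).
- exact: (integrableD measurableT iY1 iY2).
- exact: measurable_wrtD.
move=> B FB; have mB := Fm FB.
under eq_integral do rewrite EFinD.
under [RHS]eq_integral do rewrite EFinD.
rewrite !integralD_EFin// ?e1 ?e2//;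
  exact: (integrableS measurableT).
Qed.

Lemma is_condexp_id (Y : Omega -> R) :
  P.-integrable setT (EFin \o Y) -> measurable_wrt F Y -> is_condexp P F Y Y.
Proof. by []. Qed.

Lemma is_condexp0 : is_condexp P F (fun=> 0) (fun=> 0).
Proof.
apply: is_condexp_id; first exact: integrable0.
by rewrite measurable_wrtP; exact: measurable_cst.
Qed.

Lemma is_condexp_sum (I : choiceType) (A : set I) (Z Y : I -> Omega -> R) :
  finite_set A -> (forall i, A i -> is_condexp P F (Z i) (Y i)) ->
  is_condexp P F (fun w => \sum_(i \in A) Z i w)
    (fun w => \sum_(i \in A) Y i w).
Proof.
move=> finA ZY.
under [X in is_condexp _ _ X]eq_fun do rewrite fsbig_finite//=.
under [X in is_condexp _ _ _ X]eq_fun do rewrite fsbig_finite//=.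
have {}ZY i : i \in finmap.enum_fset (fset_set A) -> is_condexp P F (Z i) (Y i).
  by rewrite in_fset_set// inE; exact: ZY.
elim: (finmap.enum_fset _) ZY => [|i s ih] ZY.
  under [X in is_condexp _ _ X]eq_fun do rewrite big_nil.
  under [X in is_condexp _ _ _ X]eq_fun do rewrite big_nil.
  exact: is_condexp0.
under [X in is_condexp _ _ X]eq_fun do rewrite big_cons.
under [X in is_condexp _ _ _ X]eq_fun do rewrite big_cons.
apply: is_condexpD; first by apply: ZY; rewrite mem_head.
by apply: ih => j js; apply: ZY; rewrite in_cons js orbT.
Qed.

(** The definition sees [Z] only through its integrals, so a null set does not matter. It serves to
    replace a sum over all increments by the stopped term, which agrees with it only almost
    surely. *)
Lemma is_condexp_ae (Z Z' Y : Omega -> R) :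
  measurable_fun setT Z' -> {ae P, forall w, Z' w = Z w} ->
  is_condexp P F Z Y -> is_condexp P F Z' Y.
Proof.
move=> mZ' ZZ' [iZ iY mY e].
have mZ := measurable_int _ iZ.
have mEZ' : measurable_fun setT (EFin \o Z') by exact/measurable_EFinP.
split => //.
  apply/integrableP; split => //.
  case/integrableP: iZ => _; congr (_ < _)%E.
  apply: ae_eq_integral => //; [exact: measurableT_comp..|].
  by apply: filterS ZZ' => w /= -> _.
move=> B FB; rewrite e//; apply: ae_eq_integral.
- exact: Fm.
- exact: measurable_funTS.
- exact: measurable_funTS.
by apply: filterS ZZ' => w /= -> _.
Qed.

End conditional_expectation.

(** * Integration against mixtures of measures *)

Section mixture.
Context (R : realType) (dO dX : measure_display)
  (Omega : measurableType dO) (X : measurableType dX).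
Variable P : {measure set Omega -> \bar R}.

Import HBNNSimple.

(** The inner integral is a finite sum over the level sets of [f], and the outer integral passes
    through it. *)
Lemma integral_mixture_nnsfun (nu : Omega -> {measure set X -> \bar R})
    (C : set Omega) (f : {nnsfun X >-> R}) :
  measurable C -> (forall A, measurable A -> measurable_fun setT (nu ^~ A)) ->
  (\int[P]_(w in C) \int[nu w]_x (f x)%:E =
   \sum_(r \in range f) r%:E * \int[P]_(w in C) nu w (f @^-1` [set r]))%E.
Proof.
move=> mC mnu.
under eq_integral do rewrite integralT_nnsfun sintegralE.
rewrite ge0_integral_fsum//; last 2 first.
- by move=> r; apply: measurable_funTS; apply: measurable_funeM; exact: mnu.
- by move=> r w _; exact: nnsfun_mulemu_ge0.
apply: eq_fsbigr => r _.
(* Pulling [r] out needs [0 <= r]; for negative [r] the level set is empty and both sides are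
   zero. *)
have [r0|r0] := leP 0 r.
  by rewrite ge0_integralZl//; apply: measurable_funTS; exact: mnu.
rewrite preimage_nnfun0//.
by rewrite !integral0_eq ?mule0// => w _; rewrite measure0 ?mule0.
Qed.

(** Two mixtures that agree on sets agree on simple functions, hence on increasing limits of these:
    monotone convergence is applied to the inner integral and then to the outer one. *)
Lemma ge0_eq_integral_mixture (nu1 nu2 : Omega -> {measure set X -> \bar R})
    (C1 C2 : set Omega) (f : X -> \bar R) :
  measurable C1 -> measurable C2 ->
  (forall A, measurable A -> measurable_fun setT (nu1 ^~ A)) ->
  (forall A, measurable A -> measurable_fun setT (nu2 ^~ A)) ->
  (forall A, measurable A ->
    \int[P]_(w in C1) nu1 w A = \int[P]_(w in C2) nu2 w A)%E ->
  (forall x, 0 <= f x)%E -> measurable_fun setT f ->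
  (\int[P]_(w in C1) \int[nu1 w]_x f x =
   \int[P]_(w in C2) \int[nu2 w]_x f x)%E.
Proof.
move=> mC1 mC2 mnu1 mnu2 nu12 f0 mf; pose f_ := nnsfun_approx measurableT mf.
have fE (m : {measure set X -> \bar R}) :
    (\int[m]_x f x = limn (fun n => \int[m]_x (f_ n x)%:E))%E.
  rewrite -monotone_convergence//.
  - by apply: eq_integral => x _; apply/esym/cvg_lim => //;
      exact: cvg_nnsfun_approx.
  - by move=> n; exact/measurable_EFinP.
  - by move=> n x _; rewrite lee_fin.
  - by move=> x _ a b ab; rewrite lee_fin; exact/lefP/nd_nnsfun_approx.
have limE (nu : Omega -> {measure set X -> \bar R}) (C : set Omega) :
    measurable C -> (forall A, measurable A -> measurable_fun setT (nu ^~ A)) ->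
    (\int[P]_(w in C) \int[nu w]_x f x =
     limn (fun n => \int[P]_(w in C) \int[nu w]_x (f_ n x)%:E))%E.
  move=> mC mnu; under eq_integral do rewrite fE.
  rewrite monotone_convergence//.
  - move=> n; apply: measurable_funTS.
    apply: measurable_fun_integral_kernel => //.
    + by move=> x; rewrite lee_fin.
    + exact/measurable_EFinP.
  - by move=> n w _; apply: integral_ge0 => x _; rewrite lee_fin.
  - move=> w _ a b ab; apply: ge0_le_integral => //.
    + by move=> x _; rewrite lee_fin.
    + exact/measurable_EFinP.
    + exact/measurable_EFinP.
    + by move=> x _; rewrite lee_fin; exact/lefP/nd_nnsfun_approx.
rewrite (limE nu1 C1)// (limE nu2 C2)//; congr (limn _); apply/funext => n.
rewrite !integral_mixture_nnsfun//.
by apply: eq_fsbigr => r _; rewrite nu12.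
Qed.

End mixture.

(** * Conditional laws: from indicators to integrable functions *)

Section condexp_kernel.
Context (R : realType) (dO dX : measure_display) (Omega : measurableType dO)
  (X : measurableType dX).
Variables (P : probability Omega R) (F : set_system Omega).
Hypothesis sF : sigma_algebra [set: Omega] F.
Hypothesis Fm : F `<=` measurable.
Variables (J : Omega -> X) (D : set Omega).
Hypothesis mJ : measurable_fun [set: Omega] J.
Hypothesis mD : measurable D.
Variable nu : Omega -> {measure set X -> \bar R}.
Hypothesis nu_fin : forall w A, measurable A -> nu w A \is a fin_num.
Hypothesis nuE : forall A, measurable A ->
  is_condexp P F \1_[set w | A (J w) /\ D w] (fun w => fine (nu w A)).

Let FE := measurable_g_measurableTypeE sF.

Let mFnu A : measurable A ->
  measurable_fun [set: g_sigma_algebraType F]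
    ((fun w => nu w A) : g_sigma_algebraType F -> \bar R).
Proof.
move=> mA; have [_ _ /(measurable_wrtP sF)/measurable_EFinP mnu _] := nuE mA.
apply: eq_measurable_fun mnu => w _ /=.
by rewrite fineK// nu_fin.
Qed.

Let mFm d' (T : measurableType d') (f : Omega -> T) :
  measurable_fun [set: g_sigma_algebraType F]
    (f : g_sigma_algebraType F -> T) ->
  measurable_fun [set: Omega] f.
Proof.
move=> mf _ B mB; apply: Fm; rewrite -FE; exact: mf.
Qed.

Let mnu A : measurable A -> measurable_fun setT (nu ^~ A).
Proof. by move=> mA; apply: mFm; exact: mFnu. Qed.

(** Evaluation at [J w] is integration against the Dirac mass there, so both sides are mixtures, and
    [nuE] says that they agree on sets. *)
Lemma ge0_condexp_kernel (C : set Omega) (g : X -> \bar R) : F C ->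
  (forall x, 0 <= g x)%E -> measurable_fun setT g ->
  (\int[P]_(w in C `&` D) g (J w) = \int[P]_(w in C) \int[nu w]_x g x)%E.
Proof.
move=> FC g0 mg; have mC := Fm FC.
transitivity (\int[P]_(w in C `&` D) \int[dirac (J w)]_x g x)%E.
  by apply: eq_integral => w _; rewrite integral_dirac// diracT mul1e.
apply: ge0_eq_integral_mixture => //.
- exact: measurableI.
- move=> A mA; rewrite /dirac/=.
  apply/measurable_EFinP; apply: measurableT_comp => //.
move=> A mA; have [_ _ _ /(_ _ FC) e] := nuE mA.
rewrite integral_mkcondr.
transitivity (\int[P]_(w in C) (\1_[set w | A (J w) /\ D w] w)%:E)%E.
  apply: eq_integral => w _; rewrite patchE/= diracE !indicE.
  case: ifPn => [/set_mem Dw|/negP nDw].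
    case: (asboolP (A (J w))) => JA; first by rewrite !mem_set//; split.
    by rewrite !memNset// => -[].
  by rewrite memNset// => -[_ /mem_set].
rewrite -e; apply: eq_integral => w _.
by rewrite fineK// nu_fin.
Qed.

(** The positive and negative parts of [f] are handled by the non-negative case and then subtracted;
    [nuf] keeps the difference finite on [C]. *)
Lemma is_condexp_kernel (C : set Omega) (f : X -> R) :
  F C -> measurable_fun setT f ->
  (forall w, C w -> (nu w).-integrable setT (EFin \o f)) ->
  P.-integrable setT (EFin \o (fun w => \1_(C `&` D) w * f (J w))) ->
  is_condexp P F (fun w => \1_(C `&` D) w * f (J w))
    (fun w => \1_C w * \int[nu w]_x f x).
Proof.
move=> FC mf nuf iZ; have mC := Fm FC.
have mCD : measurable (C `&` D) by exact: measurableI.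
have mEf : measurable_fun setT (EFin \o f) by exact/measurable_EFinP.
pose f1 := ((EFin \o f)^\+)%E; pose f2 := ((EFin \o f)^\-)%E.
pose a1 w := (\int[nu w]_x f1 x)%E; pose a2 w := (\int[nu w]_x f2 x)%E.
have mf1 : measurable_fun setT f1 by exact: measurable_funepos.
have mf2 : measurable_fun setT f2 by exact: measurable_funeneg.
have f1_ge0 x : (0 <= f1 x)%E by exact: funepos_ge0.
have f2_ge0 x : (0 <= f2 x)%E by exact: funeneg_ge0.
have ma1 : measurable_fun [set: g_sigma_algebraType F]
    (a1 : g_sigma_algebraType F -> \bar R).
  exact: (@measurable_fun_integral_kernel _ _ (g_sigma_algebraType F) _ _ nu).
have ma2 : measurable_fun [set: g_sigma_algebraType F]
    (a2 : g_sigma_algebraType F -> \bar R).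
  exact: (@measurable_fun_integral_kernel _ _ (g_sigma_algebraType F) _ _ nu).
have ZE : EFin \o (fun w => \1_(C `&` D) w * f (J w)) =
    ((EFin \o f) \o J) \_ (C `&` D).
  apply/funext => w; rewrite patchE/= indicE.
  by case: ifPn => _; rewrite ?mul1r ?mul0r.
have iCD : P.-integrable (C `&` D) ((EFin \o f) \o J).
  by rewrite (integrable_mkcond _ mCD) -ZE.
have a1_fin w : C w -> a1 w \is a fin_num.
  by move=> /nuf/integrable_pos_fin_num; exact.
have a2_fin w : C w -> a2 w \is a fin_num.
  by move=> /nuf/integrable_neg_fin_num; exact.
(* By the non-negative case, the integral of [a1] over [C] is that of the positive part of [f (J w)]
   over the intersection of [C] and [D], which is finite by [iCD]. *)
have a1_int : P.-integrable C a1.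
  apply/integrableP; split; first by apply: measurable_funTS; exact: mFm.
  under eq_integral do rewrite gee0_abs ?integral_ge0//.
  rewrite -ge0_condexp_kernel// /f1 -/(comp _ J) -funepos_comp.
  exact: integral_funepos_lt_pinfty.
have a2_int : P.-integrable C a2.
  apply/integrableP; split; first by apply: measurable_funTS; exact: mFm.
  under eq_integral do rewrite gee0_abs ?integral_ge0//.
  rewrite -ge0_condexp_kernel// /f2 -/(comp _ J) -funeneg_comp.
  exact: integral_funeneg_lt_pinfty.
have YE : EFin \o (fun w => \1_C w * \int[nu w]_x f x) = (a1 \- a2)%E \_ C.
  apply/funext => w; rewrite patchE/= indicE.
  case: ifPn => [/set_mem Cw|_]; last by rewrite mul0r.
  by rewrite mul1r /Rintegral integralE fineK// fin_numB a1_fin// a2_fin.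
split => //.
- by rewrite YE -integrable_mkcond//; exact: integrableB.
- rewrite (measurable_wrtP sF); apply: measurable_funM.
    by apply: measurable_indic; rewrite FE.
  rewrite /Rintegral; apply: measurableT_comp; first exact: fine_measurable.
  under eq_fun do rewrite integralE.
  exact: emeasurable_funB.
move=> B FB; have mB := Fm FB.
have FBC : F (B `&` C) by rewrite -FE; apply: measurableI; rewrite FE.
have mBC := Fm FBC.
have sBC : B `&` C `<=` C by [].
transitivity (\int[P]_(w in B) ((a1 \- a2)%E \_ C) w)%E; first by rewrite -YE.
transitivity (\int[P]_(w in B) (((EFin \o f) \o J) \_ (C `&` D)) w)%E;
  last first.
  by rewrite -ZE.
rewrite -!integral_mkcondr setIA.
rewrite integralB//; [|exact: (integrableS mC)..].
by rewrite [RHS]integralE funepos_comp funeneg_comp !ge0_condexp_kernel.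
Qed.

End condexp_kernel.

(** * Order and truncated subtraction on index vectors *)

Section index_vectors.
Variable d : nat.
Implicit Types r s k m : natvec d.

Lemma vleP r k : reflect (forall j, (r j <= k j)%N) (vle r k).
Proof. exact: forallP. Qed.

Lemma natvec_addE s k j : (s + k) j = (s j + k j)%N.
Proof. by rewrite ffunE. Qed.

Lemma vle_addl s k m : vle s m -> vle (s + k) m = vle k (vsub m s).
Proof.
move=> /vleP sm; apply/vleP/vleP => h j; move: (h j) (sm j);
  rewrite !(natvec_addE, ffunE); lia.
Qed.

Lemma vsub_add m s k : vsub m (s + k) = vsub (vsub m s) k.
Proof. by apply/ffunP => j; rewrite !(natvec_addE, ffunE) subnDA. Qed.

Lemma vle_vsub m s : vle (vsub m s) m.
Proof. by apply/vleP => j; rewrite ffunE leq_subr. Qed.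

Lemma finite_box m : finite_set (box m).
Proof.
(* [N] bounds every coordinate, so the box lies in the image of the finite type of functions into
   ['I_N.+1]. *)
pose N := \max_j m j.
have : finite_set [set` codom (fun f : {ffun 'I_d -> 'I_N.+1} =>
    [ffun j => f j : nat] : natvec d)] by exact: finite_seq.
apply: sub_finite_set => r /vleP rm /=.
apply/codomP; exists [ffun j => inord (r j)].
apply/ffunP => j; rewrite !ffunE inordK// ltnS.
by apply: leq_trans (rm j) _; exact: leq_bigmax.
Qed.

(** The integer difference has non-negative coordinates exactly when [s] lies below [m], and there
    it equals the truncated one. *)
Lemma zext_vsub (R : realType) T (F : natvec d -> T -> R) m s x :
  zext F (intvec m - intvec s) x = if vle s m then F (vsub m s) x else 0.
Proof.
rewrite /zext; have -> : [forall j, 0 <= (intvec m - intvec s) j] = vle s m.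
  by apply: eq_forallb => j; rewrite !ffunE; lia.
case: ifPn => // /vleP sm; congr (F _ x).
by apply/ffunP => j; rewrite !ffunE; move: (sm j); lia.
Qed.

End index_vectors.

(** A preimage splits into countably many pieces according to the value of [s], and on each piece
    the function is a fixed [h i] composed with [j]. *)
Lemma measurable_fun_countable_index (dT dX : measure_display)
    (T : measurableType dT) (X : measurableType dX) (R : realType)
    (I : countType) (s : T -> I) (j : T -> X) (h : I -> X -> R) :
  (forall i, measurable (s @^-1` [set i])) -> measurable_fun setT j ->
  (forall i, measurable_fun setT (h i)) ->
  measurable_fun setT (fun t => h (s t) (j t)).
Proof.
move=> ms mj mh _ B mB; rewrite setTI.
rewrite (_ : _ @^-1` _ =
    \bigcup_i (s @^-1` [set i] `&` j @^-1` (h i @^-1` B))); last first.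
  by apply/seteqP; split=> [t Bt|t [i _ [/= <-]]//]; exists (s t).
apply: countable_bigcupT_measurable => [|i]; first exact: countableP.
apply: measurableI => //; rewrite -[X in measurable X]setTI; apply: mj => //.
by rewrite -[X in measurable X]setTI; exact: mh.
Qed.

(** * Histories, the exit time and the stopped terms *)

Section chain.
Context (R : realType) (d : nat) (dX dO : measure_display)
  (X : measurableType dX) (Omega : measurableType dO).
Variable P : probability Omega R.
Variables (J : nat -> {RV P >-> X}) (S : nat -> {RV P >-> natvec d}).

Lemma history_sigma_algebra n : sigma_algebra setT (history J S n).
Proof. exact: smallest_sigma_algebra. Qed.

Lemma history_J n i A : (i <= n)%N -> measurable A ->
  history J S n (J i @^-1` A).
Proof.
move=> ni mA; apply: sub_sigma_algebra; exists i => //; left.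
by exists A => //; rewrite setTI.
Qed.

Lemma history_S n i (A : set (natvec d)) : (i <= n)%N ->
  history J S n (S i @^-1` A).
Proof.
move=> ni; apply: sub_sigma_algebra; exists i => //; right.
by exists A => //; rewrite setTI.
Qed.

Lemma filtration_history : filtration (history J S).
Proof.
split=> n; first exact: history_sigma_algebra.
- apply: smallest_sub; first exact: sigma_algebra_measurable.
  by move=> _ [i _ [|]] [B mB <-]; exact: measurable_funP.
- apply: smallest_sub; first exact: history_sigma_algebra.
  move=> _ [i /= ni [|]] [B mB <-]; rewrite setTI.
    by apply: history_J => //; exact: leqW.
  by apply: history_S => //; exact: leqW.
Qed.

Lemma history_measurable n : history J S n `<=` measurable.
Proof. by case: filtration_history. Qed.

Lemma measurable_wrt_historyS n (Y : Omega -> R) :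
  measurable_wrt (history J S n) Y -> measurable_wrt (history J S n.+1) Y.
Proof. by case: filtration_history => _ _ h /subset_trans; apply; exact: h. Qed.

Lemma historyI n A B :
  history J S n A -> history J S n B -> history J S n (A `&` B).
Proof.
rewrite -(measurable_g_measurableTypeE (history_sigma_algebra n)).
exact: measurableI.
Qed.

(** Minimality of the exit time gives this, and an infinite exit time is covered as well. Every
    [i <= n] occurs because paths are not assumed monotone here. *)
Lemma before_exit_timeP m n w :
  reflect (forall i, (i <= n)%N -> vle (S i w) m)
    (before n (exit_time S m w)).
Proof.
rewrite /exit_time; case: pselect => [ex|nex] /=.
  case: ex_minnP => k kS kmin; apply: (iffP idP) => [nk i ni|h].
    apply/contraT => /kmin; lia.
  by rewrite ltnNge; apply: contra kS => /h.
apply: ReflectT => i _; apply/contraT => h; exfalso; apply: nex.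
by exists i.
Qed.

(** The event is a finite intersection of conditions on S_0, ..., S_n; this is the stopping time
    property. *)
Lemma history_before m n :
  history J S n [set w | before n (exit_time S m w)].
Proof.
rewrite (_ : [set _ | _] = \bigcap_(i in `I_n.+1) (S i @^-1` box m)).
  rewrite -(measurable_g_measurableTypeE (history_sigma_algebra n)).
  apply: fin_bigcap_measurable => // i ni.
  rewrite (measurable_g_measurableTypeE (history_sigma_algebra n)).
  exact: history_S.
apply/seteqP; split=> w /= => [/before_exit_timeP h i /= ni|h].
  exact: h.
by apply/before_exit_timeP => i ni; exact: h.
Qed.

(** This is U_n for [L] and V_n for [G], in the very form of the integrability hypotheses, so that
    these apply by conversion. *)
Definition stopped_term (F : natvec d -> X -> R) (m : natvec d) (n : nat)
    (w : Omega) : R :=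
  \1_[set w' | before n (exit_time S m w')] w * renewal_term J S F m n w.

Lemma stopped_termE F m n w : stopped_term F m n w =
  if before n (exit_time S m w) then F (vsub m (S n w)) (J n w) else 0.
Proof.
rewrite /stopped_term /renewal_term zext_vsub indicE.
have [h|/negP h] := boolP (before n (exit_time S m w)); last first.
  by rewrite memNset ?mul0r.
by rewrite mem_set// mul1r (before_exit_timeP m n w h n).
Qed.

(* The index m - S leaves N^d at the exit time, so the first summand of the
   process vanishes from then on. *)
Lemma renewal_processE G L m n w : renewal_process J S G L m n w =
  stopped_term L m n w + \sum_(0 <= j < n) stopped_term G m j w.
Proof.
(* [N] will be [n] or the exit time: the indices from [N] on contribute zero, and below [N] the
   indicator is one. *)
have sumE N : (N <= n)%N ->
    (forall j, (j < N)%N -> before j (exit_time S m w)) ->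
    (forall j, (N <= j < n)%N -> ~~ before j (exit_time S m w)) ->
    \sum_(0 <= j < n) stopped_term G m j w =
    \sum_(0 <= j < N) renewal_term J S G m j w.
  move=> Nn bN aN; rewrite (big_cat_nat (leq0n N) Nn)//=.
  rewrite [X in _ + X]big_nat_cond.
  rewrite [X in _ + X]big1 ?addr0; last first.
    by move=> j /andP[/aN /negbTE h _]; rewrite stopped_termE h.
  rewrite !big_nat; apply: eq_bigr => j /= jN.
  by rewrite /stopped_term indicE mem_set ?mul1r//= bN.
have bnE : before n (exit_time S m w) ->
    renewal_term J S L m n w = stopped_term L m n w.
  by move=> h; rewrite /stopped_term indicE mem_set ?mul1r.
rewrite /renewal_process; have [nb|nb] := boolP (before n (exit_time S m w)).
  have -> : stop n (exit_time S m w) = n.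
    by case: (exit_time S m w) nb => [k|]//= /ltnW/minn_idPl.
  rewrite bnE// (sumE n)// => j; last by lia.
  move=> /ltnW jn; apply/before_exit_timeP => i ij.
  exact: (before_exit_timeP m n w nb i (leq_trans ij jn)).
rewrite stopped_termE (negbTE nb) add0r; move: nb (sumE) => {bnE sumE}.
rewrite /exit_time; case: pselect => //= ex.
case: ex_minnP => k kS _; rewrite -leqNgt => kn sumE.
rewrite (minn_idPr kn) (sumE k)//; last by move=> j; lia.
by rewrite /renewal_term zext_vsub (negbTE kS) add0r.
Qed.

Lemma measurable_wrt_stopped_term F m n :
  (forall k, measurable_fun setT (F k)) ->
  measurable_wrt (history J S n) (stopped_term F m n).
Proof.
move=> mF; have sH := history_sigma_algebra n.
have HE := measurable_g_measurableTypeE sH.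
apply/(measurable_wrtP sH); apply: measurable_funM.
  by apply: measurable_indic; rewrite HE; exact: history_before.
apply: (@measurable_fun_countable_index _ _
  (g_sigma_algebraType (history J S n)) _ _ _ (S n) (J n) (fun s => zext F (intvec m - intvec s))).
- by move=> s; rewrite HE; exact: history_S.
- by move=> _ B mB; rewrite HE setTI; exact: history_J.
- move=> s; rewrite (_ : zext _ _ =
      fun x => if vle s m then F (vsub m s) x else 0); last first.
    by apply/funext => x; exact: zext_vsub.
  by case: (vle s m); [exact: mF|exact: measurable_cst].
Qed.

End chain.

(** * Consequences of total mass one *)

Section kernel_family.
Context (R : realType) (d : nat) (dX : measure_display) (X : measurableType dX).
Variable q : natvec d -> R.-ker X ~> X.
Hypothesis q_mass : total_mass_one q.

(** A single term of a non-negative family is at most the whole sum, which is one. *)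
Lemma kernel_fin_num k x A : measurable A -> q k x A \is a fin_num.
Proof.
move=> mA; rewrite ge0_fin_numE//.
apply: (@le_lt_trans _ _ 1%E); last exact: ltry.
rewrite -(q_mass x); apply: esum_ge; exists [set k].
  by split => //; exact: finite_set1.
by rewrite fsbig_set1; apply: le_measure; rewrite ?inE.
Qed.

(** The total mass is re-indexed by the codes of vectors, with zero at numbers coding none, so that
    series and integral can be exchanged later. *)
Lemma nneseries_kernel x :
  (\sum_(i <oo) (if @pickle_inv (natvec d) i is Some k then q k x setT else 0)
   = 1)%E.
Proof.
rewrite nneseries_esumT; last by move=> i; case: pickle_inv.
set a := (X in (\esum_(i in _) X i)%E).
have injp : set_inj [set: natvec d] pickle.
  by move=> k k' _ _; exact: (pcan_inj (@pickleK_inv _)).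
rewrite -(q_mass x); transitivity (\esum_(k in [set: natvec d]) a (pickle k))%E.
  rewrite -esum_image// [RHS]esum_mkcond; apply: eq_esum => i _.
  case: ifPn => // /negP ni; rewrite /a; case E : (pickle_inv i) => [k|]//.
  exfalso; apply: ni; rewrite inE; exists k => //.
  by move: (@pickle_invK (natvec d) i); rewrite E.
by apply: eq_esum => k _; rewrite /a pickleK_inv.
Qed.

End kernel_family.

(** * The one-step identity and the martingale property *)

Section renewal_martingale.
Context (R : realType) (d : nat) (dX dO : measure_display)
  (X : measurableType dX) (Omega : measurableType dO).
Variable P : probability Omega R.
Variables (J : nat -> {RV P >-> X}) (S : nat -> {RV P >-> natvec d}).
Variable q : natvec d -> R.-ker X ~> X.
Hypothesis q_mass : total_mass_one q.
Hypothesis JS_chain : markov_renewal_chain J S q.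

Let step n k := [set w | S n.+1 w = S n w + k].

Lemma measurable_step n k : measurable (step n k).
Proof.
rewrite (_ : step n k =
    \bigcup_s (S n @^-1` [set s] `&` S n.+1 @^-1` [set s + k])); last first.
  by apply/seteqP; split=> [w wk|w [s _ [/= <-]]//]; exists (S n w).
apply: countable_bigcupT_measurable => [|s]; first exact: countableP.
by apply: measurableI; rewrite -[X in measurable X]setTI;
  exact: measurable_funP.
Qed.

(** The disjoint events that the increment is [k] have probabilities equal to the means of
    [q k (J n w) setT], and these add up to one. *)
Lemma ae_step n : {ae P, forall w, exists k, S n.+1 w = S n w + k}.
Proof.
pose E i := if @pickle_inv (natvec d) i is Some k then step n k else set0.
have mE i : measurable (E i).
  by rewrite /E; case: pickle_inv => // k; exact: measurable_step.
(* Addition of vectors is cancellative, so an increment is unique and has a single code. *)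
have tE : trivIset setT E.
  move=> i j _ _ [w []]; rewrite /E.
  move: (@pickle_invK (natvec d) i) (@pickle_invK (natvec d) j).
  case: (pickle_inv i) (pickle_inv j) => [k|] [k'|]//= <- <-; rewrite /step/=.
  move=> -> /ffunP kk'; congr pickle; apply/ffunP => l; move: (kk' l).
  by rewrite !natvec_addE => /addnI.
have PE i : P (E i) = (\int[P]_w
    (if @pickle_inv (natvec d) i is Some k then q k (J n w) setT else 0))%E.
  rewrite /E; case: pickle_inv => [k|]; last by rewrite measure0 integral0.
  (* The chain property is used with the whole state space for [A], integrated over the whole of
     [Omega]. *)
  have [_ _ _] := JS_chain.2 n k setT measurableT.
  have [H0 HC _] := history_sigma_algebra J S n.
  move=> /(_ setT); rewrite -(setD0 setT) => /(_ (HC _ H0)); rewrite setD0.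
  rewrite (_ : [set _ | _] = step n k); last first.
    by apply/seteqP; split=> w // -[].
  rewrite integral_indic// ?setIT; last exact: measurable_step.
  by move=> <-; apply: eq_integral => w _; rewrite fineK// kernel_fin_num.
have PU : P (\bigcup_i E i) = 1%E.
  rewrite measure_bigcup//=.
  under eq_eseriesl do rewrite in_setT.
  under eq_eseriesr do rewrite PE.
  rewrite -integral_nneseries//.
  - under eq_integral do rewrite nneseries_kernel//.
    by rewrite integral_cst// mul1e; exact: probability_setT.
  - move=> i; case: pickle_inv => [k|]; last exact: measurable_cst.
    exact: (measurableT_comp (measurable_kernel (q k) setT measurableT)).
  - by move=> i w _; case: pickle_inv.
exists (~` \bigcup_i E i); split.
- by apply: measurableC; exact: bigcup_measurable.
- by rewrite probability_setC ?PU ?subee//; exact: bigcup_measurable.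
move=> w /= nw [i _]; rewrite /E; case: pickle_inv => // k wk.
by apply: nw; exists k.
Qed.

Variables (m : natvec d) (G L : natvec d -> X -> R).
Hypothesis G_meas : forall k, measurable_fun [set: X] (G k).
Hypothesis L_meas : forall k, measurable_fun [set: X] (L k).
Hypothesis L_conv : forall k, box m k -> kconv_converges q L k.
Hypothesis L_eq : forall k, box m k -> forall x, L k x = G k x + kconv q L k x.
Hypothesis L_int : forall n,
  P.-integrable [set: Omega] (EFin \o stopped_term J S L m n).
Hypothesis G_int : forall n,
  P.-integrable [set: Omega] (EFin \o stopped_term J S G m n).

Let at_index n s := [set w | before n (exit_time S m w)] `&` S n @^-1` [set s].

Let history_at_index n s : history J S n (at_index n s).
Proof. by apply: historyI; [exact: history_before|exact: history_S]. Qed.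

(** Here S_(n+1) = s + r still lies below [m], so the chain has not exited at time n + 1. *)
Let stopped_term_step n s r w : box m s -> box (vsub m s) r ->
  (at_index n s `&` step n r) w ->
  stopped_term J S L m n.+1 w = L (vsub (vsub m s) r) (J n.+1 w).
Proof.
move=> sm rm [[/before_exit_timeP nb sE] wr]; rewrite stopped_termE ifT.
  by rewrite wr sE vsub_add.
apply/before_exit_timeP => i; rewrite leq_eqVlt => /predU1P[->|];
  last exact: nb.
by rewrite wr sE vle_addl.
Qed.

Let is_condexp_step n s r : box m s -> box (vsub m s) r ->
  is_condexp P (history J S n)
    (fun w => \1_(at_index n s `&` step n r) w
              * L (vsub (vsub m s) r) (J n.+1 w))
    (fun w => \1_(at_index n s) w
              * \int[q r (J n w)]_y L (vsub (vsub m s) r) y).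
Proof.
move=> sm rm.
have mD : measurable (at_index n s `&` step n r).
  apply: measurableI; last exact: measurable_step.
  by apply: (@history_measurable _ _ _ _ _ _ P J S n).
apply: is_condexp_kernel => //.
- exact: history_sigma_algebra.
- exact: history_measurable.
- exact: measurable_step.
- by move=> w A mA; exact: kernel_fin_num.
- by move=> A mA; exact: JS_chain.2.
- by move=> w _; apply: L_conv => //; exact: vle_vsub.
(* On this event the summand coincides with the stopped term at n + 1, from which it inherits
   integrability. *)
have /(integrableS measurableT mD (@subsetT _ _)) := L_int n.+1.
rewrite (integrable_mkcond _ mD) restrict_EFin.
congr (integrable _ _ (EFin \o _)).
apply/funext => w; rewrite patchE indicE.
case: ifPn => [/set_mem h|_]; last by rewrite mul0r.
by rewrite mul1r (stopped_term_step sm rm h).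
Qed.

Lemma is_condexp_stopped_term n :
  is_condexp P (history J S n) (stopped_term J S L m n.+1)
    (fun w => stopped_term J S L m n w - stopped_term J S G m n w).
Proof.
have sH := history_sigma_algebra J S n.
have Hm := @history_measurable _ _ _ _ _ _ P J S n.
(* [Z] splits U_(n+1) by the value of S_n and the increment, and [Y] is its conditional expectation
   term by term. [Y] is U_n - V_n everywhere, while [Z] is U_(n+1) only almost surely. *)
pose Z w := \sum_(s \in box m) \sum_(r \in box (vsub m s))
  \1_(at_index n s `&` step n r) w * L (vsub (vsub m s) r) (J n.+1 w).
pose Y w := \sum_(s \in box m) \sum_(r \in box (vsub m s))
  \1_(at_index n s) w * \int[q r (J n w)]_y L (vsub (vsub m s) r) y.
have ZY : is_condexp P (history J S n) Z Y.
  apply: is_condexp_sum => // [|s sm]; first exact: finite_box.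
  apply: is_condexp_sum => // [|r rm]; first exact: finite_box.
  exact: is_condexp_step.
have at_indexE s w : \1_(at_index n s) w =
    (before n (exit_time S m w) && (S n w == s))%:R :> R.
  rewrite indicE; congr ((nat_of_bool _)%:R).
  apply/idP/idP => [/set_mem[-> /= ->]|/andP[nb /eqP ns]].
    by rewrite eqxx.
  by rewrite mem_set.
have YE : (fun w => stopped_term J S L m n w - stopped_term J S G m n w) = Y.
  apply/funext => w; rewrite /Y !stopped_termE.
  have [nb|nb] := boolP (before n (exit_time S m w)); last first.
    rewrite subr0 fsbig1// => s _; rewrite fsbig1// => r _.
    by rewrite at_indexE (negbTE nb) mul0r.
  have nm : box m (S n w) by exact: (before_exit_timeP S m n w nb).
  (* Only [s = S n w] survives, and its inner sum is the convolution in the renewal equation at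
     index m - S_n. *)
  rewrite (fsbigD1 (S n w) _ _ (finite_box m) nm)/=
    [X in _ = _ + X]fsbig1 ?addr0.
    rewrite L_eq; last exact: vle_vsub.
    rewrite addrAC subrr add0r; apply: eq_fsbigr => r _.
    by rewrite at_indexE nb eqxx mul1r.
  move=> s [_ /= /eqP sn]; rewrite fsbig1// => r _.
  by rewrite at_indexE eq_sym (negbTE sn) andbF mul0r.
rewrite YE; apply: is_condexp_ae ZY => //.
  by apply/measurable_EFinP; exact: measurable_int (L_int _).
apply: filterS (ae_step n) => w [k wk].
have stepE r : \1_(step n r) w = (k == r)%:R :> R.
  rewrite indicE; congr ((nat_of_bool _)%:R); apply/idP/eqP => [/set_mem|<-].
    rewrite /step/= wk => /ffunP kr; apply/ffunP => l; move: (kr l).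
    by rewrite !natvec_addE => /addnI.
  by rewrite mem_set.
have indE s r : \1_(at_index n s `&` step n r) w =
    \1_(at_index n s) w * \1_(step n r) w :> R by rewrite indicI.
have [nb|nb] := boolP (before n (exit_time S m w)); last first.
  rewrite stopped_termE ifF.
    rewrite /Z fsbig1// => s _; rewrite fsbig1// => r _.
    by rewrite indE at_indexE (negbTE nb) !mul0r.
  apply: contraNF nb => /before_exit_timeP nb; apply/before_exit_timeP => i ni.
  exact: nb (leqW ni).
have nm : box m (S n w) by exact: (before_exit_timeP S m n w nb).
rewrite /Z (fsbigD1 (S n w) _ _ (finite_box m) nm)/=
    [X in _ = _ + X]fsbig1 ?addr0; last first.
  move=> s [_ /= /eqP sn]; rewrite fsbig1// => r _.
  by rewrite indE at_indexE eq_sym (negbTE sn) andbF !mul0r.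
(* If the increment [k] fits in the remaining box, only [r = k] survives. Otherwise the chain has
   left the box at n + 1, no admissible [r] equals [k], and both sides are zero. *)
have [km|km] := pselect (box (vsub m (S n w)) k).
  rewrite (fsbigD1 k _ _ (finite_box _) km)/=
    [X in _ = _ + X]fsbig1 ?addr0; last first.
    move=> r [_ /= /eqP rk].
    by rewrite indE stepE eq_sym (negbTE rk) mulr0 mul0r.
  rewrite indE at_indexE stepE nb !eqxx !mul1r.
  by apply: stopped_term_step.
rewrite stopped_termE ifF.
  rewrite fsbig1// => r rm; rewrite indE stepE.
  by case: eqP => [kr|]; [rewrite -kr in rm|rewrite mulr0 mul0r].
apply/negbTE; apply: contra_notN km => /before_exit_timeP/(_ n.+1 (leqnn _)).
by rewrite wk vle_addl.
Qed.

Lemma martingale_renewal_process :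
  martingale P (history J S) (renewal_process J S G L m).
Proof.
have fH := filtration_history J S; have [sH Hm Hsub] := fH.
pose A n w := \sum_(0 <= j < n) stopped_term J S G m j w.
have ME n : renewal_process J S G L m n =
    fun w => stopped_term J S L m n w + A n w.
  by apply/funext => w; exact: renewal_processE.
have AS n : A n.+1 = fun w => A n w + stopped_term J S G m n w.
  by apply/funext => w; rewrite /A big_nat_recr.
have A0 : A 0%N = fun=> 0 by apply/funext => w; rewrite /A big_geq.
have A_int n : P.-integrable setT (EFin \o A n).
  elim: n => [|n ih]; first by rewrite A0; exact: integrable0.
  by rewrite AS; exact: (integrableD measurableT ih (G_int n)).
(* The compensator is predictable: its last summand at n + 1 is V_n. *)
have A_meas n : measurable_wrt (history J S n) (A n.+1).
  elim: n => [|n ih]; rewrite AS; apply: measurable_wrtD => //.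
  - rewrite A0; apply/(measurable_wrtP (sH 0%N)); exact: measurable_cst.
  - exact: measurable_wrt_stopped_term.
  - by move: ih; rewrite AS; exact: measurable_wrt_historyS.
  - exact: measurable_wrt_stopped_term.
have M_meas n : measurable_wrt (history J S n) (renewal_process J S G L m n).
  rewrite ME; apply: measurable_wrtD => //.
    exact: measurable_wrt_stopped_term.
  case: n => [|n]; last exact: measurable_wrt_historyS.
  by rewrite A0; apply/(measurable_wrtP (sH 0%N)); exact: measurable_cst.
have M_int n : P.-integrable setT (EFin \o renewal_process J S G L m n).
  by rewrite ME; exact: (integrableD measurableT (L_int n) (A_int n)).
split => // n.
(* Adding [A n.+1], which is its own conditional expectation, gives (U_n - V_n) + (A_n + V_n) = U_n
   + A_n. *)
have := is_condexpD (sH n) (Hm n) (is_condexp_stopped_term n)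
  (is_condexp_id (A_int n.+1) (A_meas n)).
rewrite -ME; congr is_condexp; rewrite ME AS; apply/funext => w.
by rewrite addrCA subrK addrC.
Qed.

End renewal_martingale.

Theorem theorem4p4 (R : realType) (d : nat) (d_gt0 : (0 < d)%N)
  (dX : measure_display) (X : measurableType dX)
  (X_standard : standard_borel R X)
  (q : natvec d -> R.-ker X ~> X)
  (q_mass : total_mass_one q) (q_strict : strict_kernel q)
  (dO : measure_display) (Omega : measurableType dO) (P : probability Omega R)
  (J : nat -> {RV P >-> X}) (S : nat -> {RV P >-> natvec d})
  (JS_chain : markov_renewal_chain J S q)
  (m : natvec d) (G L : natvec d -> X -> R)
  (G_meas : forall k, measurable_fun [set: X] (G k))
  (L_meas : forall k, measurable_fun [set: X] (L k))
  (L_conv : forall k, box m k -> kconv_converges q L k)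
  (L_eq : forall k, box m k -> forall x, L k x = G k x + kconv q L k x)
  (L_int : forall n : nat, P.-integrable [set: Omega]
     (EFin \o (fun w => \1_[set w' | before n (exit_time S m w')] w
                        * renewal_term J S L m n w)))
  (G_int : forall n : nat, P.-integrable [set: Omega]
     (EFin \o (fun w => \1_[set w' | before n (exit_time S m w')] w
                        * renewal_term J S G m n w))) :
  martingale P (history J S) (renewal_process J S G L m).
Proof.
exact: (martingale_renewal_process q_mass JS_chain).
Qed.
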